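(* Let $c_1\wedge\dots\wedge c_k$ be an instance of 3-SAT, and let $\Gamma$ and $\varphi$ be the associated $\mathcal{L}_4$-theory and $\mathcal{L}_4$-sentence: $\Gamma=\{\psi^i_1,\psi^i_2,\psi^i_3:1\le i\le k\}$ and $\varphi=(\mathsf{all}\ q\ \overline{q})$. Then $\Gamma\not\models\varphi$ if and only if $c_1\wedge\dots\wedge c_k$ is satisfiable.
   Context: Syntax of $\mathcal{L}_4$. Given a set of nouns and a set of verbs. Terms: every noun is a term; if $x$ is a term and $r$ a verb then $(r\ \mathsf{all}\ x)$ and $\overline{x}$ are terms. Sentences: $(\mathsf{all}\ x\ y)$ for terms $x,y$. Semantics. A model $\mathcal{M}$ is a set $M$ (possibly empty) with $[\![p]\!]\subseteq M$ for each noun $p$ and $[\![r]\!]\subseteq M\times M$ for each verb $r$; $[\![r\ \mathsf{all}\ x]\!]=\{m\in M: m\,[\![r]\!]\,n\text{ for all }n\in[\![x]\!]\}$; $[\![\overline{x}]\!]=M\setminus[\![x]\!]$. $\mathcal{M}\models(\mathsf{all}\ x\ y)$ iff $[\![x]\!]\subseteq[\![y]\!]$. $\Gamma\models\varphi$ means every model of $\Gamma$ satisfies $\varphi$. Construction. Let $BV$ be a set of boolean variables. Each clause is $c_i=U_i\vee V_i\vee W_i$ with $U_i,V_i,W_i$ literals (variables in $BV$ or their negations). The language has pairwise distinct nouns $\{p:P\in BV\}\cup\{q\}\cup\{y_i,z_i:1\le i\le k\}$ and verbs $\{r_i:1\le i\le k\}$, where $p$ is the noun corresponding to the variable $P$.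 For a literal $U$, the term $u$ is the noun $p$ if $U$ is the variable $P$, and the term $\overline{p}$ if $U$ is $\neg P$; similarly $v_i,w_i$ for $V_i,W_i$. Define $\psi^i_1=(\mathsf{all}\ \overline{u_i}\ (r_i\ \mathsf{all}\ y_i))$, $\psi^i_2=(\mathsf{all}\ \overline{v_i}\ (r_i\ \mathsf{all}\ \overline{y_i}))$, $\psi^i_3=(\mathsf{all}\ (r_i\ \mathsf{all}\ z_i)\ w_i)$. *)

(* Defs.v *)
From mathcomp Require Import all_boot.
From mathcomp Require Import boolp classical_sets.

Set Implicit Arguments.
Unset Strict Implicit.
Unset Printing Implicit Defensive.

Local Open Scope classical_set_scope.

Section Syntax.
Variables noun verb : Type.

Inductive term : Type :=
| Noun of noun
| RAll of verb & term   (* (r all x) *)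
| Compl of term.

Inductive sentence : Type :=
| All of term & term.   (* (all x y) *)

End Syntax.

Arguments Noun {noun verb} _.
Arguments RAll {noun verb} _ _.
Arguments Compl {noun verb} _.
Arguments All {noun verb} _ _.

Section Semantics.
Variables noun verb : Type.

Record model : Type := Model {
  carrier :> Type;
  noun_interp : noun -> set carrier;
  verb_interp : verb -> set (carrier * carrier) }.

Fixpoint interp (M : model) (x : term noun verb) : set M :=
  match x with
  | Noun p => noun_interp p
  | RAll r y => [set m | forall n : M, interp y n -> verb_interp r (m, n)]
  | Compl y => ~` interp y
  end.

Arguments interp : clear implicits.

Definition satisfies (M : model) (s : sentence noun verb) : Prop :=
  let: All x y := s in interp M x `<=` interp M y.

Definition models_theory (M : model) (Gamma : set (sentence noun verb)) : Prop :=
  forall s, Gamma s -> satisfies M s.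

Definition entails (Gamma : set (sentence noun verb)) (s : sentence noun verb) :
    Prop :=
  forall M : model, models_theory M Gamma -> satisfies M s.

End Semantics.

Arguments noun_interp {noun verb} m _.
Arguments verb_interp {noun verb} m _.
Arguments interp {noun verb} M x.

Section ThreeSat.
Variable BV : Type.

Inductive literal : Type :=
| Pos of BV
| Neg of BV.

Record clause : Type := Clause { litU : literal; litV : literal; litW : literal }.

Definition literal_value (a : BV -> bool) (l : literal) : bool :=
  match l with Pos P => a P | Neg P => ~~ a P end.

Definition clause_value (a : BV -> bool) (c : clause) : bool :=
  [|| literal_value a (litU c), literal_value a (litV c)
    | literal_value a (litW c)].

Definition satisfiable (k : nat) (c : 'I_k -> clause) : Prop :=
  exists a : BV -> bool, forall i, clause_value a (c i).

End ThreeSat.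

Section Reduction.
Variables (BV : Type) (k : nat).

(* Constructors of an inductive type are injective and pairwise disjoint, so
   these nouns are pairwise distinct. *)
Inductive sat_noun : Type :=
| nounP of BV
| nounQ
| nounY of 'I_k
| nounZ of 'I_k.

Inductive sat_verb : Type := verbR of 'I_k.

Notation sat_term := (term sat_noun sat_verb).
Notation sat_sentence := (sentence sat_noun sat_verb).

Definition literal_term (l : literal BV) : sat_term :=
  match l with
  | Pos P => Noun (nounP P)
  | Neg P => Compl (Noun (nounP P))
  end.

Variable c : 'I_k -> clause BV.

Definition psi1 (i : 'I_k) : sat_sentence :=
  All (Compl (literal_term (litU (c i)))) (RAll (verbR i) (Noun (nounY i))).

Definition psi2 (i : 'I_k) : sat_sentence :=
  All (Compl (literal_term (litV (c i))))
      (RAll (verbR i) (Compl (Noun (nounY i)))).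

Definition psi3 (i : 'I_k) : sat_sentence :=
  All (RAll (verbR i) (Noun (nounZ i))) (literal_term (litW (c i))).

Definition sat_theory : set sat_sentence :=
  \bigcup_(i in [set: 'I_k]) [set psi1 i; psi2 i; psi3 i].

End Reduction.

Arguments nounQ {BV k}.

Definition sat_goal (BV : Type) (k : nat) : sentence (sat_noun BV k) (sat_verb k) :=
  All (Noun nounQ) (Compl (Noun nounQ)).

(* Main.v *)
Require Import Defs.
From mathcomp Require Import all_boot.
From mathcomp Require Import boolp classical_sets.

(** The sentence [sat_goal], all q are non-q, says that [q] is empty; hence the
    entailment fails exactly when the theory has a model with a point in [q].

    A point [m] of any model determines the assignment making a variable true
    when [m] lies in its noun, and literals then have the truth value of the
    membership of [m] in their terms ([interp_literal_term]).  If the first two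
    literals of the clause [i] fail at [m], then [psi1] and [psi2] relate [m] by
    the verb [i] to every point inside and outside the noun [y_i], hence to
    every point of [z_i], so [psi3] puts [m] in the term of the third literal.
    So every point of a model of the theory satisfies every clause.

    Conversely, a satisfying assignment yields the one-point model [sat_model]
    of the theory, in which [q] is not empty. *)

Lemma interp_literal_term {BV : Type} {k : nat}
    (M : model (sat_noun BV k) (sat_verb k)) (m : M) (a : BV -> bool)
    (l : literal BV) :
  (forall P, noun_interp M (nounP k P) m <-> a P) ->
  interp M (literal_term k l) m <-> literal_value a l.
Proof.
move=> aP; case: l => P /=; first exact: aP.
split; first by move=> nP; apply/negP => /aP.
by move/negP => naP /aP.
Qed.

Lemma models_sat_theory_clause {BV : Type} {k : nat} (c : 'I_k -> clause BV)
    (M : model (sat_noun BV k) (sat_verb k)) (m : M) (i : 'I_k) :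
  models_theory M (sat_theory c) ->
  clause_value (fun P => `[< noun_interp M (nounP k P) m >]) (c i).
Proof.
move=> HM; set a := (X in clause_value X _).
have litP l : interp M (literal_term k l) m <-> literal_value a l.
  by apply: interp_literal_term => P; rewrite /a; split => /asboolP.
rewrite /clause_value; apply/or3P.
case: (boolP (literal_value a (litU (c i)))) => [|nU]; first by constructor 1.
case: (boolP (literal_value a (litV (c i)))) => [|nV]; first by constructor 2.
constructor 3; apply/litP.
have H1 : satisfies M (psi1 c i) by apply: HM; exists i => //; left; left.
have H2 : satisfies M (psi2 c i) by apply: HM; exists i => //; left; right.
have H3 : satisfies M (psi3 c i) by apply: HM; exists i => //; right.
apply: H3 => n _.
case: (pselect (noun_interp M (nounY BV i) n)) => yn.
  by apply: (H1 m) yn => /litP; apply/negP.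
by apply: (H2 m) yn => /litP; apply/negP.
Qed.

(** The one-point model attached to an assignment.  A variable noun is full
    when the variable is true, [q] and every [z_i] are full, [y_i] is full when
    the first literal of the clause [i] is true, and the verb [i] is full when
    the third one is.  If the third literal is false, the empty verb satisfies
    [psi3] because [z_i] is not empty, and the choice of [y_i] makes [psi1]
    vacuous on [y_i] and [psi2] a consequence of the clause. *)
Definition sat_model {BV : Type} {k : nat} (c : 'I_k -> clause BV)
    (a : BV -> bool) : model (sat_noun BV k) (sat_verb k) :=
  @Model (sat_noun BV k) (sat_verb k) unit
    (fun p _ => match p with
       | nounP P => a P
       | nounQ => True
       | nounY i => literal_value a (litU (c i))
       | nounZ _ => True
       end)
    (fun r _ => let: verbR i := r in literal_value a (litW (c i))).

Lemma sat_model_models {BV : Type} {k : nat} (c : 'I_k -> clause BV)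
    (a : BV -> bool) :
  (forall i, clause_value a (c i)) ->
  models_theory (sat_model c a) (sat_theory c).
Proof.
move=> ca s [i _].
have litP (m : sat_model c a) l :
    interp (sat_model c a) (literal_term k l) m <-> literal_value a l.
  exact: interp_literal_term.
case=> [[->|->]|->] m /=.
- by move=> nU _ U; case: nU; apply/litP.
- move=> nV _ nU; have /or3P[//|V|//] := ca i.
  by case: nV; apply/litP.
- by move=> W; apply/litP; apply: (W m).
Qed.

Theorem theorem4p2 (BV : Type) (k : nat) (c : 'I_k -> clause BV) :
  ~ entails (sat_theory c) (sat_goal BV k) <-> satisfiable c.
Proof.
split=> [nent|[a ca] ent].
  apply: contrapT => nsat; apply: nent => M HM m _ _.
  apply: nsat; exists (fun P => `[< noun_interp M (nounP k P) m >]) => i.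
  exact: models_sat_theory_clause.
by apply: (ent _ (sat_model_models c a ca) tt).
Qed.
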